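(* Let $P$ be the set of all prime numbers. The following hold. (1) The set $P$ contains no MPTQ subsets. (2) Fix a real number $r>0$ with $r\neq 1$, and let $P_r=\log_r(P)=\{\log_r p\mid p\in P\}$. Then $P_r$ contains no MSTD subsets.
   Context: For a finite set $A\subset\mathbb{R}\setminus\{0\}$, define $A\cdot A=\{ab \mid a,b\in A\}$ and $A/A=\{a/b\mid a,b\in A\}$; $A$ is MPTQ (more product than quotient) if $|A\cdot A|>|A/A|$. For a finite set $A$ of real numbers, define $A+A=\{a+b\mid a,b\in A\}$ and $A-A=\{a-b\mid a,b\in A\}$; $A$ is MSTD (more sum than difference) if $|A+A|>|A-A|$. MPTQ and MSTD sets are finite by definition. *)

(* Defs.v *)
From mathcomp Require Import all_boot all_order all_algebra finmap.
From mathcomp Require Import boolp classical_sets reals exp.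

Set Implicit Arguments.
Unset Strict Implicit.
Unset Printing Implicit Defensive.

Import Order.TTheory GRing.Theory Num.Theory.

Local Open Scope fset_scope.
Local Open Scope ring_scope.

Section Defs.
Variable R : realType.
Implicit Types (A : {fset R}) (r x : R).

Definition sumset A : {fset R} := [fset (a + b)%R | a in A, b in A].
Definition diffset A : {fset R} := [fset (a - b)%R | a in A, b in A].
Definition prodset A : {fset R} := [fset (a * b)%R | a in A, b in A].
Definition quotset A : {fset R} := [fset (a / b)%R | a in A, b in A].

Definition MSTD A : Prop := (#|` diffset A| < #|` sumset A|)%N.

Definition MPTQ A : Prop :=
  0 \notin A /\ (#|` quotset A| < #|` prodset A|)%N.

Definition real_primes : set R := [set p%:R | p in [set p : nat | prime p]]%classic.

(* The logarithm of x to the base r, meaningful for 0 < r, r != 1 and 0 < x;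
   see powR_logr. *)
Definition logr r x : R := ln x / ln r.

Lemma powR_logr r x : 0 < r -> r != 1 -> 0 < x -> r `^ logr r x = x.
Proof.
move=> r0 r1 x0.
have lnr0 : ln r != 0 by rewrite ln_eq0.
by rewrite /powR gt_eqF// /logr divfK// lnK.
Qed.

End Defs.

(* Main.v *)
(* A set of primes is a multiplicative Sidon set: by unique factorization
   a d = c b only when {a, d} = {c, b}, so that a quotient a / b with a <> b
   determines a and b.  Adding a new element to a set with n >= 1 elements
   therefore creates at most n + 1 products and exactly 2 n >= n + 1 quotients.
   Logarithms turn products into sums and quotients into differences. *)
Require Import Defs.
From mathcomp Require Import all_boot all_order all_algebra finmap.
From mathcomp Require Import boolp classical_sets reals exp.

Import Order.TTheory GRing.Theory Num.Theory.

Local Open Scope ring_scope.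
Local Open Scope classical_set_scope.

Section SymmetricImage.
Local Open Scope fset_scope.

(** A single count serves both halves of the theorem: [f] stands for product or sum, [g] for
    quotient or difference. The alternative [a = b] leaves the diagonal free, since there all
    quotients, or all differences, coincide. *)
Lemma leq_card_imfset2_sym (K : choiceType) (f g : K -> K -> K) (A : {fset K}) :
  commutative f ->
  (forall a b c d, a \in A -> b \in A -> c \in A -> d \in A ->
     g a b = g c d -> a = b \/ a = c /\ b = d) ->
  (#|` [fset f a b | a in A, b in A]| <= #|` [fset g a b | a in A, b in A]|)%N.
Proof.
move=> fC; elim/finSet_rect: A => A IHA gA.
have [->|[x xA]] := fset_0Vmem A.
  rewrite [X in (#|` X| <= _)%N](_ : _ = fset0) ?cardfs0//.
  by apply/fsetP => y; rewrite in_fset0; apply/imfset2P => -[a]; rewrite inE.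
pose B := A `\ x.
have BA a : a \in B -> a \in A by rewrite in_fsetD1 => /andP[].
have xB a : a \in B -> x <> a.
  by rewrite in_fsetD1 => /andP[/eqP ax _] xa; apply: ax.
have IHB : (#|` [fset f a b | a in B, b in B]| <=
            #|` [fset g a b | a in B, b in B]|)%N.
  apply: IHA; first exact: fproperD1.
  by move=> a b c d /BA aA /BA bA /BA cA /BA dA; exact: gA.
have cA : #|` A| = #|` B|.+1 by rewrite (cardfsD1 x) xA.
(* By commutativity [f a x] is already [f x a], so one row, indexed by [A], contains all the new
   values. *)
have leF : (#|` [fset f a b | a in A, b in A]| <=
            #|` [fset f a b | a in B, b in B]| + #|` A|)%N.
  apply: (@leq_trans #|` [fset f a b | a in B, b in B] `|` [fset f x a | a in A]|).
    apply/fsubset_leq_card/fsubsetP => _ /imfset2P[a aA [b bA ->]].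
    rewrite in_fsetU; have [->|ax] := eqVneq a x.
      by apply/orP; right; apply/imfsetP; exists b.
    have [->|bx] := eqVneq b x.
      by apply/orP; right; apply/imfsetP; exists a; last exact: fC.
    apply/orP; left; apply/imfset2P.
    by exists a; rewrite ?in_fsetD1 ?ax//; exists b; rewrite ?in_fsetD1 ?bx.
  apply: (leq_trans (leq_card_fsetU _ _).1).
  by rewrite leq_add2l; exact: leq_imfset_card.
(* The comparison of n + 1 with 2 n fails at n = 0; for a singleton the diagonal value [g x x] makes
   up for it. *)
have [B0|[y yB]] := fset_0Vmem B.
  apply: (leq_trans leF); rewrite cA B0 cardfs0.
  rewrite [X in (#|` X| + _ <= _)%N](_ : _ = fset0).
    rewrite cardfs0 cardfs_gt0; apply/fset0Pn; exists (g x x).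
    by apply/imfset2P; exists x => //; exists x.
  by apply/fsetP => z; rewrite in_fset0; apply/imfset2P => -[a]; rewrite inE.
pose G1 := [fset g x a | a in B]; pose G2 := [fset g a x | a in B].
pose G0 := [fset g a b | a in B, b in B].
have cG1 : #|` G1| = #|` B|.
  apply: card_in_imfset => a b aB bB /gA[] //; try exact: BA.
    by move=> /(xB _ aB).
  by case.
have cG2 : #|` G2| = #|` B|.
  apply: card_in_imfset => a b aB bB /gA[] //; try exact: BA.
    by move=> /esym/(xB _ aB).
  by case.
have d12 : G1 `&` G2 = fset0.
  apply/eqP/fset0Pn => -[z]; rewrite in_fsetI => /andP[/imfsetP[a aB ->]].
  move=> /imfsetP[b bB] /gA[] //; try exact: BA.
    exact: xB.
  by case=> /(xB _ bB).
have d0 : G0 `&` (G1 `|` G2) = fset0.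
  apply/eqP/fset0Pn => -[z]; rewrite in_fsetI in_fsetU.
  (* The equation is reversed because [gA] offers equality of the left pair: that pair must be the
     one containing [x], which is off the diagonal, whereas [a = b] is possible. *)
  case/andP=> /imfset2P[a aB [b bB ->]] /orP[] /imfsetP[c cB] /esym /gA[] //;
    try exact: BA.
  - exact: xB.
  - by case=> /(xB _ aB).
  - by move=> /esym/(xB _ cB).
  - by case=> _ /(xB _ bB).
have leG : (#|` G0| + (#|` B| + #|` B|) <=
            #|` [fset g a b | a in A, b in A]|)%N.
  rewrite -{1}cG1 -cG2 -(cardfsUI G1) d12 cardfs0 addn0.
  rewrite -cardfsUI d0 cardfs0 addn0.
  apply/fsubset_leq_card/fsubsetP => z; rewrite !in_fsetU.
  case/or3P => [/imfset2P[a /BA aA [b /BA bA ->]]|/imfsetP[b /BA bA ->]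
               |/imfsetP[a /BA aA ->]]; apply/imfset2P.
  - by exists a => //; exists b.
  - by exists x => //; exists b.
  - by exists a => //; exists x.
apply: (leq_trans leF); apply: leq_trans leG.
rewrite leq_add// cA -addn1 leq_add2l cardfs_gt0.
by apply/fset0Pn; exists y.
Qed.

End SymmetricImage.

(** By Euclid's lemma [p] divides [p'] or [q], hence equals it; in the first case cancelling [p]
    leaves [q' = q]. *)
Lemma prime_mul_eq (p q p' q' : nat) : prime p -> prime q -> prime p' ->
  (p * q' = p' * q)%N -> p = q \/ p = p' /\ q = q'.
Proof.
move=> pp pq pp' e.
have : (p %| p' * q)%N by rewrite -e dvdn_mulr.
rewrite Euclid_dvdM// !dvdn_prime2// => /orP[/eqP E|/eqP]; last by left.
right; split=> //; apply/eqP.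
by rewrite -(eqn_pmul2l (prime_gt0 pp)) e E.
Qed.

(** This is the cross-multiplied form of an equality of quotients, to which both halves of the
    theorem reduce. *)
Lemma real_primes_mul_eq (R : realType) (a b c d : R) :
  real_primes a -> real_primes b -> real_primes c -> real_primes d ->
  a * d = c * b -> a = b \/ a = c /\ b = d.
Proof.
move=> [p pp <-] [q pq <-] [p' pp' <-] [q' _ <-] /eqP.
rewrite -!natrM eqr_nat => /eqP /(prime_mul_eq _ _ _ _ pp pq pp').
by case=> [->|[-> ->]]; [left|right].
Qed.

Lemma real_primes_gt0 (R : realType) (x : R) : real_primes x -> 0 < x.
Proof. by case=> p pp <-; rewrite ltr0n prime_gt0. Qed.

Theorem theorem1p6 (R : realType) :
  (forall A : {fset R}, [set` A] `<=` @real_primes R -> ~ MPTQ A)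
  /\
  (forall r : R, 0 < r -> r != 1 ->
     forall A : {fset R}, [set` A] `<=` logr r @` @real_primes R -> ~ MSTD A).
Proof.
split=> [A AP [_]|r r0 r1 A AP]; rewrite /MSTD ltnNge; apply/negP/negPn.
  apply: leq_card_imfset2_sym => [|a b c d /AP aP /AP bP /AP cP /AP dP /eqP].
    exact: mulrC.
  rewrite eqr_div ?lt0r_neq0 ?real_primes_gt0// => /eqP.
  exact: real_primes_mul_eq.
apply: leq_card_imfset2_sym => [|a b c d]; first exact: addrC.
move=> /AP[x xP <-] /AP[y yP <-] /AP[z zP <-] /AP[t tP <-] /eqP.
have lnr0 : ln r != 0 by rewrite ln_eq0.
have [[[x0 y0] z0] t0] := (real_primes_gt0 _ _ xP, real_primes_gt0 _ _ yP,
                           real_primes_gt0 _ _ zP, real_primes_gt0 _ _ tP).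
(* Each difference is the logarithm of a quotient, divided by [ln r]. Cancelling [ln r] takes only
   [ln r != 0], so bases below 1 need no separate case; injectivity of [ln] on positive reals then
   gives [x / y = z / t]. *)
rewrite /logr -!mulrBl (inj_eq (mulIf _)) ?invr_eq0// -!ln_div ?posrE//.
move=> /eqP/ln_inj; rewrite !posrE !divr_gt0// => /(_ isT isT)/eqP.
rewrite eqr_div ?lt0r_neq0// => /eqP /(real_primes_mul_eq _ _ _ _ _ xP yP zP tP).
by case=> [->|[-> ->]]; [left|right].
Qed.
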